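(* $\mathrm{cof}(\mathcal{M})=\max\{\mathfrak{d},\mathrm{supcov}\}$.
   Context: $\mathcal{M}$ is the meager ideal; $\mathfrak{d}$ the dominating number. Yorioka ideals: for $\sigma\in(2^{<\omega})^\omega$, $[\sigma]_\infty=\{x\in2^\omega:\exists^\infty n\,(\sigma(n)\subseteq x)\}$, $h_\sigma(i)=|\sigma(i)|$; $f\ll g$ iff $\forall k\,\forall^\infty n\,(f(n^k)\leq g(n))$; $\mathcal{J}_g=\{X\subseteq2^\omega:\exists\sigma\,(X\subseteq[\sigma]_\infty,\ h_\sigma=g)\}$; $\mathcal{I}_f=\bigcup_{g\gg f}\mathcal{J}_g$. $\mathrm{supcov}=\sup\{\mathrm{cov}(\mathcal{I}_f):f\in\omega^\omega\text{ increasing}\}$. *)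

(* Defs.v *)
From HB Require Import structures.
From mathcomp Require Import all_boot all_order.
From mathcomp Require Import boolp classical_sets functions cardinality.
From mathcomp Require Import topology cantor.

Set Implicit Arguments.
Unset Strict Implicit.
Unset Printing Implicit Defensive.

Import Order.TTheory.

Local Open Scope classical_set_scope.
Local Open Scope card_scope.

(* A cardinal is an equipotence class of subsets of [set cantor_space], so only
   the cardinals up to 2^(2^aleph_0) are represented.  They form an initial
   segment of all cardinals and contain the cardinality of every family of
   subsets of 2^omega and of every family of functions from omega to omega;
   minima and suprema of sets of such cardinals are thus the usual ones.
   (A type of equipotence classes of arbitrary types would be too large for the
   monomorphic universe of [set].)  Leibniz equality of cardinals is
   equipotence, see [cardinal_of_eq]. *)
Definition equipotence_class (A : set (set cantor_space)) :
    set (set (set cantor_space)) :=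
  [set B | B #= A].

Record cardinal := Cardinal {
  cardinal_class : set (set (set cantor_space)) ;
  _ : exists A, cardinal_class = equipotence_class A }.

Definition cardinal_of (A : set (set cantor_space)) : cardinal :=
  Cardinal (ex_intro _ A (erefl (equipotence_class A))).

Definition has_cardinality (T : Type) (A : set T) (c : cardinal) :=
  exists2 B, cardinal_class c B & B #= A.

Lemma cardinal_of_eq (A B : set (set cantor_space)) :
  cardinal_of A = cardinal_of B <-> A #= B.
Proof.
split=> [[e]|AB].
  have : equipotence_class B A by rewrite -e; exact: card_eqxx.
  by [].
have e : equipotence_class A = equipotence_class B.
  apply/seteqP; split=> C /= h; first exact: card_eq_trans h AB.
  by apply: card_eq_trans h _; rewrite card_eq_sym.
rewrite /cardinal_of; move: (ex_intro _ A _) (ex_intro _ B _).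
by rewrite e => p q; rewrite (Prop_irrelevance p q).
Qed.

Lemma cardinal_ofP (c : cardinal) : exists A, c = cardinal_of A.
Proof.
case: c => C p; case: (p) => A e; exists A; subst C.
by congr Cardinal; exact: Prop_irrelevance.
Qed.

Lemma has_cardinality_of (T : Type) (A : set T) B :
  has_cardinality A (cardinal_of B) <-> B #= A.
Proof.
split=> [[C CB CA]|BA]; last by exists B; first exact: card_eqxx.
by apply: card_eq_trans CA; rewrite card_eq_sym.
Qed.

Lemma has_cardinality_ex (T : Type) (A : set T) :
  A #<= [set: set cantor_space] -> exists c, has_cardinality A c.
Proof.
by move=> /card_subP[B BA _]; exists (cardinal_of B); apply/has_cardinality_of.
Qed.

HB.instance Definition _ := gen_eqMixin cardinal.
HB.instance Definition _ := gen_choiceMixin cardinal.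

Definition cardinal_le (a b : cardinal) : bool :=
  `[< exists A B, [/\ cardinal_class a A, cardinal_class b B & A #<= B] >].

Lemma cardinal_le_of (A B : set (set cantor_space)) :
  cardinal_le (cardinal_of A) (cardinal_of B) = (A #<= B).
Proof.
apply/asboolP/idP => [[A' [B' [AA BB le]]]|le].
  by rewrite -(card_le_eql AA) -(card_le_eqr BB).
by exists A, B; split=> //; exact: card_eqxx.
Qed.

Lemma cardinal_le_refl : reflexive cardinal_le.
Proof.
by move=> c; have [A ->] := cardinal_ofP c; rewrite cardinal_le_of card_lexx.
Qed.

Lemma cardinal_le_anti : antisymmetric cardinal_le.
Proof.
move=> a b; have [A ->] := cardinal_ofP a; have [B ->] := cardinal_ofP b.
rewrite !cardinal_le_of => /andP[AB BA]; apply/cardinal_of_eq.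
exact: Cantor_Bernstein.
Qed.

Lemma cardinal_le_trans : transitive cardinal_le.
Proof.
move=> b a c; have [A ->] := cardinal_ofP a; have [B ->] := cardinal_ofP b.
by have [C ->] := cardinal_ofP c; rewrite !cardinal_le_of; exact: card_le_trans.
Qed.

Lemma injective_card_le (T U : Type) (f : T -> U) :
  injective f -> [set: T] #<= [set: U].
Proof.
move=> finj; apply: (@card_le_trans _ _ _ (range f)); last exact: card_leT.
by have := inj_card_eq (in2W finj : {in [set: T] &, injective f});
  rewrite card_eq_le => /andP[].
Qed.

(* Well-foundedness of the comparison of cardinals: a maximal subset of the
   product of the [T i] on which all projections are injective projects onto
   some [T i]. *)
Lemma least_type (I : Type) (T : I -> Type) : inhabited I ->
  exists i, forall j, exists f : T i -> T j, injective f.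
Proof.
move=> [i0].
pose inj_proj (P : set (forall i, T i)) :=
  forall i p q, P p -> P q -> p i = q i -> p = q.
pose X := {P | inj_proj P}.
pose R (P Q : X) : bool := `[< sval P `<=` sval Q >].
have [|||C Ctot|[P Pinj] Pmax] := @Zorn X R.
- by move=> P; apply/asboolP.
- move=> P Q S /asboolP PQ /asboolP QS; apply/asboolP.
  exact: subset_trans PQ QS.
- move=> [P p] [Q q] /asboolP /= PQ /asboolP /= QP.
  have PQe : P = Q by rewrite eqEsubset; split.
  by subst Q; congr exist; exact: Prop_irrelevance.
- have Uinj : inj_proj (\bigcup_(P in C) sval P).
    move=> i p q [P CP Pp] [Q CQ Qq].
    have [/asboolP PQ|/asboolP QP] := Ctot _ _ CP CQ.
      by apply: (svalP Q) => //; exact: PQ.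
    by apply: (svalP P) => //; exact: QP.
  exists (exist _ _ Uinj) => P CP; apply/asboolP => /= p Pp; by exists P.
have [[i iP]|] := pselect (exists i, forall y, exists2 p, P p & p i = y).
  have {}iP y : exists p, P p /\ p i = y by have [p Pp e] := iP y; exists p.
  exists i => j; have [g gP] := choice iP.
  exists (fun y => g y j) => y z /= e.
  have [[Py <-] [Pz <-]] := (gP y, gP z); by rewrite (Pinj _ _ _ Py Pz e).
move=> /forallNP noi.
have {}noi i : exists y : T i, forall p, P p -> p i <> y.
  have /existsNP[y yP] := noi i; exists y => p Pp e; apply: yP; by exists p.
pose g i : T i := sval (cid (noi i)).
have gP i p : P p -> p i <> g i by rewrite /g; case: cid => y /= /[apply].
have Qinj : inj_proj (P `|` [set g]).
  move=> i p q [Pp|->] [Pq|->] //; first exact: (Pinj i).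
    by move=> /(gP i p Pp).
  by move=> /esym /(gP i q Pq).
have : R (exist _ P Pinj) (exist _ _ Qinj).
  by apply/asboolP => /= p Pp; left.
move=> /Pmax [] QP; have : (P `|` [set g]) g by right.
by rewrite QP => /(gP i0); case.
Qed.

Lemma least_set (I : Type) (A : I -> set (set cantor_space)) : inhabited I ->
  exists i, forall j, A i #<= A j.
Proof.
move=> /(least_type A)[i iP]; exists i => j; have [f] := iP j.
move=> /injective_card_le.
by rewrite (card_le_eql (card_setT _)) (card_le_eqr (card_setT _)).
Qed.

Lemma cardinal_le_total : total cardinal_le.
Proof.
move=> a b; have [A ->] := cardinal_ofP a; have [B ->] := cardinal_ofP b.
rewrite !cardinal_le_of.
have [] := @least_set bool (fun x => if x then A else B) (inhabits true).
by move=> [] /=; [move=> /(_ false)|move=> /(_ true)] => ->; rewrite ?orbT.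
Qed.

Fact cardinal_display : Order.disp_t. Proof. exact: Order.Disp tt tt. Qed.

HB.instance Definition _ := Order.Le_isPOrder.Build cardinal_display cardinal
  cardinal_le_refl cardinal_le_anti cardinal_le_trans.
HB.instance Definition _ := Order.POrder_isTotal.Build cardinal_display cardinal
  cardinal_le_total.

Definition cardinal0 : cardinal := cardinal_of set0.

(* The least element of [S]; the default [cardinal0] is only taken for
   [S = set0], see [cardinal_minP]. *)
Definition cardinal_min (S : set cardinal) : cardinal :=
  xget cardinal0 (S `&` lbound S).

Definition cardinal_sup (S : set cardinal) : cardinal := supremum cardinal0 S.

Lemma cardinal_minP (S : set cardinal) : S !=set0 ->
  S (cardinal_min S) /\ lbound S (cardinal_min S).
Proof.
move=> [c Sc]; suff : exists m, (S `&` lbound S) m.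
  by move=> [m Sm]; exact: (xgetI cardinal0 Sm).
pose A (x : {c | S c}) := sval (cid (cardinal_ofP (sval x))).
have AE x : sval x = cardinal_of (A x) by rewrite /A; case: cid.
have [x xP] := least_set A (inhabits (exist _ c Sc)).
exists (sval x); split=> [|d Sd]; first exact: (svalP x).
have -> : d = cardinal_of (A (exist _ d Sd)) by rewrite -AE.
by rewrite AE; have := xP (exist _ d Sd); rewrite -cardinal_le_of.
Qed.

Lemma cardinal_supP (S : set cardinal) : supremums S (cardinal_sup S).
Proof.
have cardinal_ge0 c : (cardinal0 <= c)%O.
  have [A ->] := cardinal_ofP c.
  by have := @card_ge0 (set cantor_space) _ A; rewrite -cardinal_le_of.
rewrite /cardinal_sup /supremum; case: ifPn => [/eqP ->|S0].
  by split=> [? []|? _].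
have [|ub lb] := @cardinal_minP (ubound S).
  exists (cardinal_of setT) => c _; have [A ->] := cardinal_ofP c.
  by have := card_leT A; rewrite -cardinal_le_of.
exact: (xgetI cardinal0 (conj ub lb)).
Qed.

Definition is_covering (I F : set (set cantor_space)) :=
  F `<=` I /\ \bigcup_(A in F) A = [set: cantor_space].

Definition is_cofinal (I F : set (set cantor_space)) :=
  F `<=` I /\ forall A, I A -> exists2 B, F B & A `<=` B.

Definition cov (I : set (set cantor_space)) : cardinal :=
  cardinal_min [set c | exists2 F, is_covering I F & has_cardinality F c].

Definition cof (I : set (set cantor_space)) : cardinal :=
  cardinal_min [set c | exists2 F, is_cofinal I F & has_cardinality F c].

Definition eventually_le (f g : nat -> nat) :=
  \forall n \near \oo, (f n <= g n)%N.

Definition is_dominating (D : set (nat -> nat)) :=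
  forall f, exists2 g, D g & eventually_le f g.

Definition dominating_number : cardinal :=
  cardinal_min [set c | exists2 D, is_dominating D & has_cardinality D c].

Definition nowhere_dense (T : topologicalType) (A : set T) :=
  interior (closure A) = set0.

Definition meager (T : topologicalType) : set (set T) :=
  [set A | exists2 F : nat -> set T,
    forall n, nowhere_dense (F n) & A = \bigcup_n F n].
Arguments meager T : clear implicits.

Definition initial_segment (s : seq bool) (x : cantor_space) :=
  forall i, (i < size s)%N -> nth false s i = x i.

(* The set written [sigma]_oo in the literature. *)
Definition infinitely_often (sigma : nat -> seq bool) : set cantor_space :=
  [set x | forall m, exists2 n, (m <= n)%N & initial_segment (sigma n) x].

Definition height (sigma : nat -> seq bool) : nat -> nat :=
  fun i => size (sigma i).

Definition much_less (f g : nat -> nat) :=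
  forall k, \forall n \near \oo, (f (n ^ k) <= g n)%N.

Definition yorioka_J (g : nat -> nat) : set (set cantor_space) :=
  [set X | exists2 sigma, X `<=` infinitely_often sigma & height sigma = g].

Definition yorioka (f : nat -> nat) : set (set cantor_space) :=
  \bigcup_(g in [set g | much_less f g]) yorioka_J g.

Definition increasing (f : nat -> nat) := {homo f : m n / (m < n)%N}.

Definition supcov : cardinal :=
  cardinal_sup [set cov (yorioka f) | f in increasing].

Lemma yorioka_covering f : increasing f ->
  is_covering (yorioka f) (yorioka f).
Proof.
move=> fincr; split=> //; rewrite -subTset => x _.
exists [set x] => //; exists (fun n => f (n ^ n)%N).
  move=> k; near=> n.
  have fmono : {mono f : m n / (m <= n)%N} := leq_mono fincr.
  rewrite fmono; have [k0 kn] : (0 < n)%N /\ (k <= n)%N.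
    by split; near: n; [exact: nbhs_infty_gt|exact: nbhs_infty_ge].
  exact: leq_pexp2l.
exists (fun n => mkseq x (f (n ^ n)%N)); last first.
  by apply/funext => n; rewrite /height size_mkseq.
move=> _ -> m; exists m => // i; rewrite size_mkseq => im.
by rewrite nth_mkseq.
Unshelve. all: by end_near. Qed.

Lemma covP f : increasing f ->
  exists2 F, is_covering (yorioka f) F & has_cardinality F (cov (yorioka f)).
Proof.
move=> fincr; have [|//] := @cardinal_minP
  [set c | exists2 F, is_covering (yorioka f) F & has_cardinality F c].
have [c fc] := has_cardinality_ex (card_leT (yorioka f)).
by exists c, (yorioka f); first exact: yorioka_covering.
Qed.

Lemma cofP I : exists2 F, is_cofinal I F & has_cardinality F (cof I).
Proof.
have [|//] := @cardinal_minP
  [set c | exists2 F, is_cofinal I F & has_cardinality F c].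
have [c Ic] := has_cardinality_ex (card_leT I).
by exists c, I => //; split=> // A IA; exists A.
Qed.

Lemma dominating_numberP :
  exists2 D, is_dominating D & has_cardinality D dominating_number.
Proof.
have [|//] := @cardinal_minP
  [set c | exists2 D, is_dominating D & has_cardinality D c].
pose graph (f : nat -> nat) : cantor_space := fun m =>
  if @unpickle (nat * nat)%type m is Some (a, b) then f a == b else false.
have graph_inj : injective (fun f => [set graph f]).
  move=> f g fg; apply/funext => a; apply/esym/eqP.
  have : [set graph g] (graph f) by rewrite -fg.
  move=> /(congr1 (fun h : nat -> bool => h (pickle (a, f a)))).
  by rewrite /graph pickleK eqxx => <-.
have [c cT] := has_cardinality_ex (injective_card_le graph_inj).
exists c, setT => // f; exists f => //; exact: nearW.
Qed.

(* Main.v *)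
(** For an increasing [h] let [I_n = [h n, h (n + 1))], and say that [z] matches
    [(x, h)] when [z] and [x] agree on infinitely many of the blocks [I_n].  The
    complement of such a matching set is meager, and every meager set is
    contained in one of this form.

    Lower bound.  If every real matching [(y, h)] matches [(x, j)], then almost
    every second block of [h] contains a block of [j], whatever [x] is.  Letting
    [j] outgrow a given function, we see that a cofinal family of meager sets
    yields a dominating family.  Choosing a point outside each of its members
    gives a nonmeager set; reading strings [sigma n] of prescribed lengths off
    its points [y], starting at position [n], we get sets [[sigma]_oo] in the
    Yorioka ideal, and they cover the space, since a given [x] lies in
    [[sigma]_oo] for all [y] outside a meager set (Rothberger's argument).

    Upper bound.  A meager set avoids all reals matching some [(x, j)] with [j]
    built from a dominating family.  A covering by sets in the Yorioka ideal of
    [n |-> j (n + 1)] provides, for each of its members [[sigma]_oo], the point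
    [y] that agrees with [sigma n] on the [n]-th block of [j]; if the member
    contains [x], then [x] matches [(y, j)].  A second element of the dominating
    family merges the blocks so that almost every merged block contains one of
    agreement of [x] and [y].  The resulting cofinal family is indexed by
    triples, and infinite cardinals equal their squares. *)

Require Import Defs.
From mathcomp Require Import all_boot all_order.
From mathcomp Require Import boolp classical_sets functions cardinality.
From mathcomp Require Import topology cantor.

Set Implicit Arguments.
Unset Strict Implicit.
Unset Printing Implicit Defensive.

Import Order.TTheory.

Local Open Scope classical_set_scope.
Local Open Scope card_scope.

(** * Infinite cardinals *)

Lemma card_le_total (T U : Type) (A : set T) (B : set U) :
  A #<= B \/ B #<= A.
Proof.
have [b bP] := least_type (fun b : bool => if b then set_type A else set_type B)
  (inhabits true).
have := bP (~~ b); case: b {bP} => -[f /injective_card_le fle]; [left|right].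
  by rewrite -(card_le_eql (card_setT A)) -(card_le_eqr (card_setT B)).
by rewrite -(card_le_eql (card_setT B)) -(card_le_eqr (card_setT A)).
Qed.

Lemma card_le_infinite (T U : Type) (A : set T) (B : set U) :
  A #<= B -> infinite_set A -> infinite_set B.
Proof. by move=> AB; apply: contra_not; exact: card_le_finite. Qed.

Lemma card_le_setX (T T' U U' : Type) (A : set T) (A' : set T')
    (B : set U) (B' : set U') :
  A #<= A' -> B #<= B' -> A `*` B #<= A' `*` B'.
Proof.
elim/Ppointed: T' => T' in A' *.
  by rewrite !emptyE => -> _; rewrite !set0X.
elim/Ppointed: U' => U' in B' *.
  by rewrite !emptyE => _ ->; rewrite !setX0.
move=> /pcard_leP/injfunPex[f fA finj] /pcard_leP/injfunPex[g gB ginj].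
apply/pcard_leP/injfunPex; exists (fun p => (f p.1, g p.2)).
  by move=> p [Ap Bp]; split; [exact: fA|exact: gB].
move=> [a b] [a' b']; rewrite !inE => -[Aa Bb] [Aa' Bb'] [faa' gbb'].
by congr pair; [apply: finj|apply: ginj]; rewrite ?inE.
Qed.

Lemma card_le_setU_setX (T U : Type) (A B : set T) (C : set U) :
  infinite_set C -> A #<= C -> B #<= C -> A `|` B #<= C `*` C.
Proof.
elim/Ppointed: U => U in C *; first by rewrite !emptyE.
move=> Cinf /pcard_leP/injfunPex[f fA finj] /pcard_leP/injfunPex[g gB ginj].
have [a Ca] := infinite_setN0 Cinf.
have [b [Cb ba]] := infinite_setN0 (infinite_setD Cinf (finite_set1 a)).
apply/pcard_leP/injfunPex.
exists (fun x => if x \in A then (a, f x) else (b, g x)).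
  move=> x ABx; case: ifPn; rewrite (inE, notin_setE) => Ax.
    by split=> //; exact: fA.
  by split=> //; apply: gB; case: ABx.
move=> x y; rewrite !inE => ABx ABy.
case: ifPn => Ax; case: ifPn => Ay => -[].
- by move=> /finj ->.
- by move=> ab; case: ba.
- by move=> ab; case: ba.
- move: Ax Ay; rewrite !notin_setE => nAx nAy.
  have [//|Bx] := ABx; have [//|By] := ABy.
  by apply: ginj; rewrite inE.
Qed.

Section Pairings.
Variable T : Type.
Implicit Types (P Q : set T * (T * T -> T)).

Definition pairing P :=
  set_fun (P.1 `*` P.1) P.1 P.2 /\ set_inj (P.1 `*` P.1) P.2.

Definition pairing_le P Q :=
  P.1 `<=` Q.1 /\ {in P.1 `*` P.1, P.2 =1 Q.2}.

Lemma pairing_le_refl P : pairing_le P P.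
Proof. by split. Qed.

Lemma pairing_le_trans P Q S :
  pairing_le P Q -> pairing_le Q S -> pairing_le P S.
Proof.
move=> [PQ ePQ] [QS eQS]; split; first exact: subset_trans QS.
move=> p pP; rewrite ePQ// eQS//.
by move: pP; rewrite !inE => -[]; split; exact: PQ.
Qed.

Lemma pairing_chain_ub (F : set (set T * (T * T -> T))) :
  F `<=` pairing -> total_on F pairing_le ->
  exists2 Q, pairing Q & forall P, F P -> pairing_le P Q.
Proof.
move=> Fpair Ftot; pose B := \bigcup_(P in F) P.1.
have common P P' : F P -> F P' ->
    exists Q, [/\ F Q, pairing_le P Q & pairing_le P' Q].
  move=> FP FP'; have [PP'|P'P] := Ftot _ _ FP FP'.
    by exists P'; split=> //; exact: pairing_le_refl.
  by exists P; split=> //; exact: pairing_le_refl.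
have /choice[f fE] p : exists z, forall P, F P -> (P.1 `*` P.1) p -> P.2 p = z.
  have [[P [FP Pp]]|noP] := pselect (exists P, F P /\ (P.1 `*` P.1) p).
    exists (P.2 p) => P' FP' P'p; have [Q [_ PQ P'Q]] := common _ _ FP FP'.
    by rewrite PQ.2 ?P'Q.2 ?inE.
  by exists p.1 => P FP Pp; case: noP; exists P.
have coverB p : (B `*` B) p -> exists2 P, F P & (P.1 `*` P.1) p.
  move=> [[P FP Pp] [P' FP' P'p]]; have [Q [FQ PQ P'Q]] := common _ _ FP FP'.
  by exists Q => //; split; [exact: PQ.1|exact: P'Q.1].
exists (B, f) => [|P FP]; last first.
  by split=> [x Px|p]; [exists P|rewrite inE; exact: fE].
split=> /= [p /coverB[P FP Pp]|p q].
  by exists P => //; rewrite -(fE p P)//; exact: (Fpair _ FP).1.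
rewrite !inE => /coverB[P FP Pp] /coverB[P' FP' P'q].
have [Q [FQ [PQ _] [P'Q _]]] := common _ _ FP FP'.
have Qp : (Q.1 `*` Q.1) p by case: Pp; split; exact: PQ.
have Qq : (Q.1 `*` Q.1) q by case: P'q; split; exact: P'Q.
by rewrite -(fE p Q)// -(fE q Q)// => /(Fpair _ FQ).2; apply; rewrite inE.
Qed.

Lemma pairing_maximal P : pairing P -> exists Q,
  [/\ pairing Q, pairing_le P Q & forall S, pairing S -> pairing_le Q S ->
    S.1 `<=` Q.1].
Proof.
move=> Ppair; pose X := {Q | pairing Q /\ pairing_le P Q}.
have [||A Atot|[Q [Qpair PQ]] Qmax] :=
    @ZL_preorder X (exist _ P (conj Ppair (pairing_le_refl P)))
      (fun u v => `[< pairing_le (sval u) (sval v) >]).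
- by move=> Q; apply/asboolP; exact: pairing_le_refl.
- move=> Q S V /asboolP QS /asboolP SV; apply/asboolP.
  exact: pairing_le_trans QS SV.
- have [||Q Qpair Qub] := @pairing_chain_ub (P |` (sval @` A)).
  + by move=> _ [->//|[Q _ <-]]; exact: (svalP Q).1.
  + move=> _ _ [->|[Q AQ <-]] [->|[S AS <-]].
    * by left; exact: pairing_le_refl.
    * by left; exact: (svalP S).2.
    * by right; exact: (svalP Q).2.
    * by have [/asboolP|/asboolP] := Atot _ _ AQ AS; [left|right].
  + have PQ : pairing_le P Q by apply: Qub; left.
    exists (exist _ Q (conj Qpair PQ)) => S AS.
    by apply/asboolP; apply: Qub; right; exists S.
- exists Q; split=> // S Spair QS.
  have PS := pairing_le_trans PQ QS.
  have := Qmax (exist _ S (conj Spair PS)) (asboolT QS).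
  by move=> /asboolP[].
Qed.

End Pairings.

Lemma pairing_card (T : pointedType) (B : set T) (f : T * T -> T) :
  pairing (B, f) -> B `*` B #<= B.
Proof. by move=> [fB finj]; apply/pcard_leP/injfunPex; exists f. Qed.

(* On the pairs outside [B `*` B], the extension of [f] is any injection into
   [D]; there is one since these pairs are at most as many as [B]. *)
Lemma pairing_extend (T : pointedType) (B D : set T) (f : T * T -> T) :
  pairing (B, f) -> infinite_set B -> D `<=` ~` B -> D #= B ->
  exists2 f', pairing (B `|` D, f') & pairing_le (B, f) (B `|` D, f').
Proof.
move=> Bpair Binf DB DeqB; set C := B `|` D.
have [/= fB finj] := Bpair; have BB := pairing_card Bpair.
have CB : C #<= B.
  apply: card_le_trans BB; apply: card_le_setU_setX => //.
  by rewrite (card_le_eql DeqB).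
have /pcard_leP/injfunPex[k kD kinj] : (C `*` C) `\` (B `*` B) #<= D.
  rewrite (card_le_eqr DeqB).
  apply: card_le_trans (card_le_setD _ _) _.
  exact: card_le_trans (card_le_setX CB CB) BB.
have notBk p : (C `*` C) p -> p \notin B `*` B -> ~ B (k p).
  by rewrite notin_setE => Cp nBp; apply: DB; exact: kD.
have Bf p : p \in B `*` B -> B (f p) by rewrite inE; exact: fB.
exists (fun p => if p \in B `*` B then f p else k p); last first.
  by split=> [x Bx|p /= Bp]; [left|rewrite Bp].
split=> /= [p Cp|p q].
  by case: ifPn => [/Bf|]; [left|rewrite notin_setE => nBp; right; exact: kD].
rewrite !inE => Cp Cq; case: ifPn => Bp; case: ifPn => Bq.
- exact: finj.
- by move=> fk; case: (notBk q); rewrite -?fk//; exact: Bf.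
- by move=> kf; case: (notBk p); rewrite ?kf//; exact: Bf.
- by apply: kinj; rewrite inE; split=> //; rewrite -notin_setE.
Qed.

Lemma pairing_maximal_card (T : pointedType) (B : set T) (f : T * T -> T) :
  pairing (B, f) -> infinite_set B ->
  (forall Q, pairing Q -> pairing_le (B, f) Q -> Q.1 `<=` B) ->
  [set: T] #<= B.
Proof.
move=> Bpair Binf Bmax.
have [BcB|/card_subP[D DeqB DB]] := card_le_total (~` B) B.
  rewrite -(setUv B); apply: card_le_trans (pairing_card Bpair).
  exact: card_le_setU_setX.
have [Q Qpair BQ] := pairing_extend Bpair Binf DB DeqB.
have [d Dd] : D !=set0.
  apply: infinite_setN0; apply: card_le_infinite Binf.
  by rewrite (card_le_eqr DeqB).
have nBd : ~ B d := DB d Dd.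
by case: nBd; apply: (Bmax _ Qpair BQ); right.
Qed.

Lemma card_setXTT_le (T : Type) :
  infinite_set [set: T] -> [set: T] `*` [set: T] #<= [set: T].
Proof.
elim/Ppointed: T => T Tinf.
  by have [x _] := infinite_setN0 Tinf; case: (no x).
have /infiniteP/card_subP[N Neq _] := Tinf.
have /pcard_leP/injfunPex[e eN einj] : N `*` N #<= N.
  rewrite (card_le_eqr Neq) -(card_le_eqr card_nat2) -setXTT.
  by apply: card_le_setX; rewrite (card_le_eql Neq).
have [[B f] [Bpair [/= NB _] Bmax]] :=
  pairing_maximal (conj eN einj : pairing (N, e)).
have Binf : infinite_set B.
  by apply: sub_infinite_set NB _; apply/infiniteP; rewrite -(card_le_eql Neq).
have TB := pairing_maximal_card Bpair Binf Bmax.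
apply: card_le_trans (card_le_setX TB TB) _.
exact: card_le_trans (pairing_card Bpair) (card_leT B).
Qed.

Lemma card_setX_le (T : Type) (A : set T) : infinite_set A -> A `*` A #<= A.
Proof.
move=> Ainf; rewrite -(card_le_eqr (card_setT A)).
have AT : A #<= [set: A] by rewrite (card_le_eqr (card_setT A)).
apply: card_le_trans (card_le_setX AT AT) _.
exact/card_setXTT_le/(card_le_infinite AT).
Qed.

Lemma card_bigcup_le (I T U : Type) (D : set I) (F : I -> set T) (K : set U) :
  infinite_set K -> D #<= K -> (forall i, D i -> F i #<= K) ->
  \bigcup_(i in D) F i #<= K.
Proof.
elim/Ppointed: T => T in F *; first by rewrite emptyE.
elim/Ppointed: I => I in D F *.
  by rewrite (empty_eq0 D) bigcup_set0 => *; exact: card_ge0.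
move=> Kinf /pcard_surjP[g gD] FK.
have /choice[h hF] i : exists h : U -> T, D i -> set_surj K (F i) h.
  have [/FK/pcard_surjP[h hF]|nDi] := pselect (D i); first by exists h.
  by exists (fun=> point).
apply: card_le_trans (card_setX_le Kinf); apply/pcard_surjP.
exists (fun p => h (g p.1) p.2) => x [i Di Fx].
have [a Ka gai] := gD i Di; have [b Kb hbx] := hF i Di x Fx.
by exists (a, b) => //=; rewrite gai.
Qed.

(** * Nowhere dense and meager sets *)

Section NowhereDense.
Variable T : topologicalType.
Implicit Types A B : set T.

Lemma nowhere_dense_dense A : nowhere_dense A <-> dense (~` closure A).
Proof.
split=> [A0 O [x Ox] Oopen|Adense].
  apply: contrapT => nO; have : (closure A)° x; last by rewrite A0.
  suff : O `<=` (closure A)° by apply.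
  rewrite -open_subsetE// => y Oy.
  by apply: contrapT => Ay; apply: nO; exists y.
apply/seteqP; split=> // x Ax.
have [|y [Ay nAy]] := Adense _ (ex_intro _ x Ax); first exact: open_interior.
by apply: nAy; exact: interior_subset Ay.
Qed.

Lemma nowhere_dense_subset A B :
  A `<=` B -> nowhere_dense B -> nowhere_dense A.
Proof.
move=> AB B0; apply/seteqP; split=> // x.
rewrite -[X in _ -> X x]B0; apply: interiorS; exact: closureS.
Qed.

Lemma nowhere_denseU A B :
  nowhere_dense A -> nowhere_dense B -> nowhere_dense (A `|` B).
Proof.
move=> /nowhere_dense_dense Ad /nowhere_dense_dense Bd.
apply/nowhere_dense_dense; rewrite closureU setCU; apply: denseI => //.
by rewrite openC; exact: closed_closure.
Qed.

Lemma nowhere_dense_bigsetU (F : nat -> set T) n :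
  (forall i, nowhere_dense (F i)) ->
  nowhere_dense (\big[setU/set0]_(i < n) F i).
Proof.
move=> F0; apply: (big_ind (@nowhere_dense T)) => //.
  by rewrite /nowhere_dense closure0 interior0.
exact: nowhere_denseU.
Qed.

Definition limsup_set (F : nat -> set T) : set T :=
  [set x | forall m, exists2 n, (m <= n)%N & F n x].

Lemma meager_setC_limsup (F : nat -> set T) :
  (forall m, nowhere_dense (~` \bigcup_(n >= m) F n)) ->
  meager T (~` limsup_set F).
Proof.
move=> F0; exists (fun m => ~` \bigcup_(n >= m) F n) => //.
rewrite -setC_bigcap; congr setC.
by apply/seteqP; split=> [x Fx m _|x Fx m]; [exact: Fx|exact: (Fx m I)].
Qed.

End NowhereDense.

(** * The Cantor space *)

Definition agree_on (I : set nat) (x : cantor_space) : set cantor_space :=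
  [set y | forall i, I i -> y i = x i].

Lemma agree_onS I J x : I `<=` J -> agree_on J x `<=` agree_on I x.
Proof. by move=> IJ y yx i /IJ; exact: yx. Qed.

Local Notation cylinder x n := (agree_on `I_n x).

Lemma subset_cylinder x m n : (m <= n)%N -> cylinder x n `<=` cylinder x m.
Proof. by move=> mn; apply: agree_onS => i /= im; exact: leq_trans im mn. Qed.

Lemma nbhs_cylinder (x : cantor_space) n : nbhs x (cylinder x n).
Proof.
elim: n => [|n IHn]; first by apply: filterS filterT => y _ i.
have xn : nbhs x [set y : cantor_space | y n = x n].
  apply: (@proj_continuous nat (fun=> bool) n x [set x n]).
  exact: discrete_set1.
apply: filterS (filterI IHn xn) => y [yn yxn] i.
by rewrite /= ltnS leq_eqVlt => /orP[/eqP ->|/yn].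
Qed.

Lemma nbhs_cylinderP (x : cantor_space) (U : set cantor_space) :
  nbhs x U <-> exists n, cylinder x n `<=` U.
Proof.
split=> [|[n nU]]; last exact: filterS nU (nbhs_cylinder x n).
pose F : set_system cantor_space := filter_from setT (fun n => cylinder x n).
have FF : Filter F.
  apply: filter_from_filter; first by exists 0.
  move=> m n _ _; exists (maxn m n) => // y yx.
  by split; apply: subset_cylinder yx; rewrite (leq_maxl, leq_maxr).
have Fx : F --> x.
  apply/cvg_sup => i; apply/cvg_image.
    by apply/seteqP; split=> // b _; exists (fun=> b).
  move=> A /nbhs_singleton Ax; exists [set y : cantor_space | A (y i)].
    by exists i.+1 => // y yx /=; rewrite yx//=.
  by apply/seteqP; split=> [_ [y Ay <-]//|b Ab]; exists (fun=> b).
by move=> /Fx[n _ nU]; exists n.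
Qed.

Lemma nowhere_denseP (A : set cantor_space) : nowhere_dense A <->
  forall x n, exists2 y, cylinder x n y & exists m, cylinder y m `<=` ~` A.
Proof.
split=> [A0 x n|Adense].
  have [y xy Ay] : exists2 y, cylinder x n y & (~` closure A) y.
    apply: contrapT => /forall2NP allA.
    have : (closure A)° x; last by rewrite A0.
    apply/nbhs_cylinderP; exists n => y xy.
    by have [] := allA y => // nAy; exact: contrapT.
  by exists y => //; apply/nbhs_cylinderP; rewrite -interiorC in Ay.
apply/seteqP; split=> // x /nbhs_cylinderP[n nA].
have [y /nA yA /nbhs_cylinderP] := Adense x n.
by rewrite -[nbhs _ _]/((~` A)° y) interiorC.
Qed.

Definition splice n (x y : cantor_space) : cantor_space :=
  fun i => if (i < n)%N then x i else y i.

Lemma splice_cylinder n x y : cylinder x n (splice n x y).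
Proof. by move=> i /= lt_in; rewrite /splice lt_in. Qed.

Lemma splice_above n x y : agree_on [set i | (n <= i)%N] y (splice n x y).
Proof. by move=> i /= ni; rewrite /splice ltnNge ni. Qed.

Lemma meager_setC_limsup_cylinder (F : nat -> set cantor_space) :
  (forall x n, exists2 y, cylinder x n y &
    exists m k, (n <= k)%N /\ cylinder y m `<=` F k) ->
  meager cantor_space (~` limsup_set F).
Proof.
move=> Fdense; apply: meager_setC_limsup => m; apply/nowhere_denseP => x n.
have [y xy [p [k [nmk yF]]]] := Fdense x (maxn n m).
move: nmk; rewrite geq_max => /andP[_ mk].
exists y; first by apply: subset_cylinder xy; exact: leq_maxl.
by exists p => z /yF Fz; rewrite setCK; exists k.
Qed.

(** * Matching a real on infinitely many blocks *)

Definition block (h : nat -> nat) (n : nat) : set nat :=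
  [set i | (h n <= i < h n.+1)%N].

Definition matching (x : cantor_space) (h : nat -> nat) : set cantor_space :=
  limsup_set (fun n => agree_on (block h n) x).

Lemma matching_self x h : matching x h x.
Proof. by move=> m; exists m. Qed.

Lemma increasing_geq h n : increasing h -> (n <= h n)%N.
Proof.
move=> hinc; elim: n => // n IHn; apply: leq_ltn_trans IHn _.
exact: hinc.
Qed.

Lemma block_inj h m n i : increasing h -> block h m i -> block h n i -> m = n.
Proof.
move=> hinc /andP[mi im] /andP[ni lt_in]; have lt := leqW_mono (leq_mono hinc).
apply/eqP; rewrite eqn_leq -ltnS -lt (leq_ltn_trans mi lt_in) /=.
by rewrite -ltnS -lt (leq_ltn_trans ni im).
Qed.

Lemma splice_blocks h (y : nat -> cantor_space) : increasing h ->
  exists x, forall n, agree_on (block h n) x (y n).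
Proof.
move=> hinc.
have /choice[x xP] i : exists b, forall n, block h n i -> y n i = b.
  have [[n ni]|nex] := pselect (exists n, block h n i).
    by exists (y n i) => m mi; rewrite (block_inj hinc mi ni).
  by exists false => n ni; case: nex; exists n.
by exists x => n i; exact: xP.
Qed.

Lemma meager_setC_matching x h : increasing h ->
  meager cantor_space (~` matching x h).
Proof.
move=> hinc; apply: meager_setC_limsup_cylinder => y n.
exists (splice n y x); first exact: splice_cylinder.
exists (h n.+1), n; split=> // z zy i /andP[ni im].
by rewrite zy// splice_above//; exact: leq_trans (increasing_geq n hinc) ni.
Qed.

Fixpoint iterate_blocks (e : nat -> nat) (n : nat) : nat :=
  if n is k.+1 then
    maxn (iterate_blocks e k).+1 (\max_(i < (iterate_blocks e k).+1) e i)
  else 0.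

Lemma increasing_iterate_blocks e : increasing (iterate_blocks e).
Proof. by apply: homo_ltn => [? ? ?|n]; [exact: ltn_trans|exact: leq_maxl]. Qed.

Lemma leq_iterate_blocks e i n :
  (i <= iterate_blocks e n)%N -> (e i <= iterate_blocks e n.+1)%N.
Proof.
rewrite -ltnS => lt_in; apply: leq_trans (leq_maxr _ _).
exact: (leq_bigmax (Ordinal lt_in)).
Qed.

Lemma matching_iterate_blocks h e x y : increasing h ->
  (\forall i \near \oo, exists k, [/\ (i <= h k)%N, (h k.+1 <= e i)%N &
    agree_on (block h k) x y]) ->
  matching y (iterate_blocks e) `<=` matching x h.
Proof.
move=> hinc [N _ NP] z zy m.
have [n] := zy (maxn N (h m)); rewrite geq_max => /andP[Nn mn] zyn.
have ni := increasing_geq n (@increasing_iterate_blocks e).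
have [k [ik kei xy]] := NP _ (leq_trans Nn ni).
exists k => [|j /[dup] kj /andP[hkj jhk]].
  by rewrite -(leq_mono hinc) (leq_trans mn)// (leq_trans ni).
rewrite zyn ?xy// /block/= (leq_trans ik hkj)/=.
by apply: leq_trans jhk (leq_trans kei _); exact: leq_iterate_blocks.
Qed.

Lemma matching_iterate_blocks_coarser h e x : increasing h ->
  eventually_le (h \o succn) e ->
  matching x (iterate_blocks e) `<=` matching x h.
Proof.
move=> hinc [N _ he]; apply: matching_iterate_blocks => //.
by exists N => // i /he hei; exists i; split=> //; exact: increasing_geq.
Qed.

Lemma matching_iterate_blocks_eventually h x y :
  increasing h -> matching y h x ->
  exists v, forall d, eventually_le v d ->
    matching y (iterate_blocks d) `<=` matching x h.
Proof.
move=> hinc xy.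
have /choice[v vP] i : exists v, exists k, [/\ (i <= h k)%N, (h k.+1 <= v)%N &
    agree_on (block h k) x y].
  have [k ik xyk] := xy i; exists (h k.+1), k; split=> //.
    exact: leq_trans ik (increasing_geq k hinc).
  by move=> j /xyk.
exists v => d [N _ vd]; apply: matching_iterate_blocks => //.
exists N => // i /vd vdi; have [k [ik kv xyk]] := vP i.
by exists k; split=> //; exact: leq_trans vdi.
Qed.

(* Only every other block of [h] is used: an interval covered by
   pairwise non-adjacent blocks lies inside one of them. *)
Lemma sub_matching_block x j y h : increasing j -> increasing h ->
  matching y h `<=` matching x j ->
  \forall n \near \oo, exists k, (h n.*2 <= j k)%N /\ (j k.+1 <= h n.*2.+1)%N.
Proof.
move=> jinc hinc sub.
pose contains_block n := exists k, (h n.*2 <= j k)%N /\ (j k.+1 <= h n.*2.+1)%N.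
pose bad := \bigcup_(n in ~` contains_block) block h n.*2.
apply: contrapT => nle.
pose z : cantor_space := fun i => if i \in bad then y i else ~~ x i.
have yz : matching y h z.
  move=> m; have [n mn nbad] : exists2 n, (m <= n)%N & ~ contains_block n.
    apply: contrapT => /forall2NP allin; apply: nle; exists m => // n mn.
    by have [//|] := allin n; exact: contrapT.
  exists n.*2; first by rewrite -addnn; exact: leq_trans (leq_addr _ _).
  by move=> i ni; rewrite /z mem_set//; exists n.
have [k _ zxk] := sub z yz 0.
have jbad i : block j k i -> bad i.
  by move=> /zxk; rewrite /z; case: ifPn => [/set_mem//|_]; case: (x i).
have jk : (j k < j k.+1)%N by exact: jinc.
have [|n nbad /andP[nk kn]] := jbad (j k); first by rewrite /block/= leqnn.
have nk1 : (h n.*2.+1 < j k.+1)%N.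
  by rewrite ltnNge; apply/negP => kn1; apply: nbad; exists k.
have [|l _ ln] := jbad (h n.*2.+1); first by rewrite /block/= (ltnW kn).
have := block_inj hinc ln (_ : block h n.*2.+1 _).
rewrite /block/= leqnn hinc// => /(_ isT)/(congr1 odd).
by rewrite /= !odd_double.
Qed.

(** * Meager sets in the Cantor space *)

Definition translate (t z : cantor_space) : cantor_space :=
  fun i => z i (+) t i.

Lemma nowhere_dense_translate t (A : set cantor_space) :
  nowhere_dense A -> nowhere_dense (translate t @^-1` A).
Proof.
move=> /nowhere_denseP Adense; apply/nowhere_denseP => x n.
have [y xy [m yA]] := Adense (translate t x) n.
exists (translate t y) => [i /xy|].
  by rewrite /translate => ->; rewrite addbK.
exists m => z yz; apply: yA => i /yz.
by rewrite /translate => ->; rewrite addbK.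
Qed.

(* Forgetting one more coordinate adds the translate that flips it. *)
Lemma nowhere_dense_forget (A : set cantor_space) n : nowhere_dense A ->
  nowhere_dense (\bigcup_(w in A) agree_on [set i | (n <= i)%N] w).
Proof.
move=> A0; elim: n => [|n IHn].
  apply: nowhere_dense_subset A0 => z [w Aw zw].
  by have -> : z = w by apply/funext => i; exact: zw.
set S := \bigcup_(w in A) _ in IHn *.
pose t : cantor_space := fun i => i == n.
have := nowhere_denseU IHn (nowhere_dense_translate t IHn).
apply: nowhere_dense_subset.
move=> z [w Aw zw]; have [zwn|zwn] := eqVneq (z n) (w n); [left|right];
  exists w => // i /=; rewrite leq_eqVlt => /predU1P[<-|lt_ni].
- by [].
- exact: zw.
- by rewrite /translate /t eqxx; case: (z n) (w n) zwn => [] [].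
- by rewrite /translate /t zw// gtn_eqF// addbF.
Qed.

Lemma nowhere_dense_block (A : set cantor_space) n : nowhere_dense A ->
  exists y m, agree_on [set i | (n <= i < m)%N] y `<=` ~` A.
Proof.
move=> /(nowhere_dense_forget n)/nowhere_denseP/(_ point 0)[y _ [m yA]].
exists y, m => z zy Az; apply: (yA (splice n y z)); last first.
  by exists z => //; exact: splice_above.
move=> i /= im; rewrite /splice; case: ltnP => // ni.
by rewrite zy//= ni.
Qed.

Lemma meager_sub_setC_matching (A : set cantor_space) : meager cantor_space A ->
  exists x h, increasing h /\ A `<=` ~` matching x h.
Proof.
move=> [F F0 ->].
have /choice[y yP] n : exists y, exists m,
    agree_on [set i | (n <= i < m)%N] y `<=` ~` \big[setU/set0]_(i < n) F i.
  exact/nowhere_dense_block/nowhere_dense_bigsetU.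
have {yP}/choice[e eP] := yP; pose h := iterate_blocks e.
have hinc : increasing h := @increasing_iterate_blocks e.
have [x xy] := splice_blocks (y \o h) hinc.
exists x, h; split=> // z [i _ Fz] /(_ i.+1)[n lt_in zx].
have hn := increasing_geq n hinc.
apply: (eP (h n) z); last first.
  by rewrite -bigcup_mkord; exists i => //=; exact: leq_trans lt_in hn.
move=> l /andP[nl le]; have nbl : block h n l.
  by rewrite /block/= nl/=; apply: leq_trans le _; exact: leq_iterate_blocks.
by rewrite zx// -(xy n).
Qed.

Lemma meager_setC_neq0 (A : set cantor_space) :
  meager cantor_space A -> ~` A !=set0.
Proof.
move=> /meager_sub_setC_matching[x [h [_ Ax]]].
by exists x => /Ax; apply; exact: matching_self.
Qed.

(** * Comparison of the cardinals *)

Lemma has_cardinality_le (T U : Type) (A : set T) (B : set U) a b :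
  has_cardinality A a -> has_cardinality B b -> (a <= b)%O = (A #<= B).
Proof.
have [A' ->] := cardinal_ofP a; have [B' ->] := cardinal_ofP b.
move=> /has_cardinality_of AA /has_cardinality_of BB.
rewrite -[LHS]/(cardinal_le _ _) cardinal_le_of.
by rewrite (card_le_eql AA) (card_le_eqr BB).
Qed.

Lemma cardinal_min_le_card (T U : Type) (P : set (set T)) (G : set T)
    (F : set U) c :
  P G -> G #<= F -> has_cardinality F c ->
  (cardinal_min [set a | exists2 H, P H & has_cardinality H a] <= c)%O.
Proof.
move=> PG GF Fc; have [g Gg] : exists g, has_cardinality G g.
  apply: has_cardinality_ex; case: Fc => F' _ F'F.
  by apply: card_le_trans GF _; rewrite -(card_le_eql F'F) card_leT.
apply: (@le_trans _ _ g); last by rewrite (has_cardinality_le Gg Fc).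
have Pg : [set a | exists2 H, P H & has_cardinality H a] g by exists G.
by have [_] := @cardinal_minP _ (ex_intro _ g Pg); exact.
Qed.

Lemma dominating_number_le_cof_meager :
  (dominating_number <= cof (meager cantor_space))%O.
Proof.
have [F [FM Fcof] Fcard] := cofP (meager cantor_space).
have /choice[h hP] (B : set cantor_space) : exists h, meager cantor_space B ->
    increasing h /\ exists y, B `<=` ~` matching y h.
  have [MB|nMB] := pselect (meager cantor_space B); last by exists id.
  have [y [h [hinc sub]]] := meager_sub_setC_matching MB.
  by exists h => _; split=> //; exists y.
pose bound B k := h B k.*2.+1.
apply: cardinal_min_le_card (card_image_le bound F) Fcard => f.
pose j := iterate_blocks f; have jinc := @increasing_iterate_blocks f.
have [B FB jB] := Fcof _ (meager_setC_matching point jinc).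
have [hinc [y By]] := hP B (FM _ FB).
exists (bound B); first by exists B.
have yj : matching y (h B) `<=` matching point j.
  by apply: subsetC2; exact: subset_trans jB By.
have [N _ NP] := sub_matching_block jinc hinc yj.
exists N => // n /NP[k [nk kn]]; apply: leq_trans (leq_iterate_blocks _) kn.
apply: leq_trans nk; apply: leq_trans (increasing_geq _ hinc).
by rewrite -addnn leq_addr.
Qed.

Definition windows (g : nat -> nat) (y : cantor_space) (n : nat) : seq bool :=
  mkseq (fun i => y (n + i)) (g n).

Lemma meager_not_windows g x :
  meager cantor_space [set y | ~ infinitely_often (windows g y) x].
Proof.
apply: (@meager_setC_limsup_cylinder
  (fun n => [set y | initial_segment (windows g y n) x])) => y n.
exists (splice n y (fun i => x (i - n))); first exact: splice_cylinder.
exists (n + g n), n; split=> // z zy i; rewrite size_mkseq => ign.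
rewrite nth_mkseq// zy/= ?ltn_add2l// splice_above/= ?leq_addr//.
by rewrite addKn.
Qed.

Lemma cov_yorioka_le_cof_meager f : increasing f ->
  (cov (yorioka f) <= cof (meager cantor_space))%O.
Proof.
move=> finc.
have [F [FM Fcof] Fcard] := cofP (meager cantor_space).
have /choice[y yP] (B : set cantor_space) :
    exists y, meager cantor_space B -> ~ B y.
  have [MB|nMB] := pselect (meager cantor_space B); last by exists point.
  by have [y nBy] := meager_setC_neq0 MB; exists y.
pose g n := f (n ^ n).
apply: cardinal_min_le_card
  (card_image_le (fun B => infinitely_often (windows g (y B))) F) Fcard.
split=> [_ [B FB <-]|].
  exists g.
    move=> k; exists k.+1 => // n /= kn; rewrite (leq_mono finc).
    by apply: leq_pexp2l; [exact: leq_trans kn|exact: ltnW].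
  exists (windows g (y B)) => //.
  by apply/funext => n; rewrite /height size_mkseq.
rewrite -subTset => x _.
have [B FB xB] := Fcof _ (meager_not_windows g x).
exists (infinitely_often (windows g (y B))); first by exists B.
by apply: contrapT => /xB; exact: yP (FM _ FB).
Qed.

Lemma infinite_dominating D : is_dominating D -> infinite_set D.
Proof.
move=> Ddom /finite_seqP[s sD].
have [g] := Ddom (fun n => (\sum_(g <- s) g n).+1).
rewrite sD /= => gs [N _ /(_ N (leqnn N))] /=.
by rewrite (big_rem g)//= ltnNge leq_addr.
Qed.

Lemma yorioka_sub_matching h A : increasing h -> yorioka (h \o succn) A ->
  exists y, A `<=` matching y h.
Proof.
move=> hinc [g /(_ 1)[N _ hg] [sigma Asigma sg]].
have [y yP] := splice_blocks (fun n => nth false (sigma n)) hinc.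
exists y => x /Asigma xs m; have [n] := xs (maxn N m).
rewrite geq_max => /andP[Nn mn] nx; exists n => // i /[dup] ni /andP[_ im].
rewrite -(yP n)// nx//; apply: leq_trans im _.
by rewrite -[size _]/(height sigma n) sg -[n in h n.+1]expn1; exact: hg.
Qed.

Lemma matching_cover (T : Type) (K : set T) c h :
  has_cardinality K c -> (supcov <= c)%O -> increasing h ->
  exists2 Y, Y #<= K & \bigcup_(y in Y) matching y h = setT.
Proof.
move=> Kc supc hinc; pose f := h \o succn.
have finc : increasing f by move=> m n mn; exact: hinc.
have [F [FI Fcov] Fc] := covP finc.
have FK : F #<= K.
  rewrite -(has_cardinality_le Fc Kc); apply: le_trans supc.
  have [ub _] := cardinal_supP [set cov (yorioka f) | f in increasing].
  by apply: ub; exists f.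
have /choice[y yP] A : exists y, F A -> A `<=` matching y h.
  have [FA|nFA] := pselect (F A); last by exists point.
  by have [y yP] := yorioka_sub_matching hinc (FI _ FA); exists y.
exists (y @` F); first exact: card_le_trans (card_image_le _ _) FK.
rewrite -subTset -Fcov => x [A FA Ax].
by exists (y A); [exists A|exact: yP].
Qed.

Lemma is_cofinal_setC_matching D (Y : (nat -> nat) -> set cantor_space) :
  is_dominating D ->
  (forall h, increasing h -> \bigcup_(y in Y h) matching y h = setT) ->
  is_cofinal (meager cantor_space)
    (\bigcup_(e in D) \bigcup_(y in Y (iterate_blocks e))
      [set ~` matching y (iterate_blocks d) | d in D]).
Proof.
move=> Ddom Ycov; split=> [_ [e _ [y _ [d _ <-]]]|A MA].
  exact/meager_setC_matching/increasing_iterate_blocks.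
have [x [h [hinc Ax]]] := meager_sub_setC_matching MA.
have [e De he] := Ddom (h \o succn); set j := iterate_blocks e.
have jinc : increasing j := @increasing_iterate_blocks e.
have [y Yy yx] : (\bigcup_(y in Y j) matching y j) x by rewrite Ycov.
have [v vP] := matching_iterate_blocks_eventually jinc yx.
have [d Dd vd] := Ddom v.
exists (~` matching y (iterate_blocks d)).
  by exists e => //; exists y => //; exists d.
apply: subset_trans Ax _; apply: subsetC.
exact: subset_trans (vP d vd) (matching_iterate_blocks_coarser hinc he).
Qed.

Lemma cof_meager_le_max :
  (cof (meager cantor_space) <= Order.max dominating_number supcov)%O.
Proof.
set c := Order.max _ _; have [K KE] := cardinal_ofP c.
have Kc : has_cardinality K c by rewrite KE; apply/has_cardinality_of.
have [D Ddom Dd] := dominating_numberP.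
have DK : D #<= K by rewrite -(has_cardinality_le Dd Kc) le_max lexx.
have Kinf : infinite_set K := card_le_infinite DK (infinite_dominating Ddom).
have supc : (supcov <= c)%O by rewrite le_max lexx orbT.
have /choice[Y YP] h : exists Y : set cantor_space, increasing h ->
    Y #<= K /\ \bigcup_(y in Y) matching y h = setT.
  have [hinc|ninc] := pselect (increasing h); last by exists set0.
  by have [Y YK Ycov] := matching_cover Kc supc hinc; exists Y.
have Ycov h : increasing h -> \bigcup_(y in Y h) matching y h = setT.
  by move=> /YP[].
apply: cardinal_min_le_card (is_cofinal_setC_matching Ddom Ycov) _ Kc.
apply: card_bigcup_le => // e _; apply: card_bigcup_le => // [|y _].
  by have [] := YP _ (@increasing_iterate_blocks e).
exact: card_le_trans (card_image_le _ _) DK.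
Qed.

Theorem theorem3p20 :
  cof (meager cantor_space) = Order.max dominating_number supcov.
Proof.
apply/eqP; rewrite eq_le cof_meager_le_max ge_max.
rewrite dominating_number_le_cof_meager /=.
have [_ lub] := cardinal_supP [set cov (yorioka f) | f in increasing].
by apply: lub => _ [f finc <-]; exact: cov_yorioka_le_cof_meager.
Qed.
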